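(* Let $\boldsymbol{\pi}\in\mathfrak{S}_n$ be exactly $k$-stack-sortable. Then $\triangle:=\operatorname{conv}(\mathcal{S}^{\boldsymbol{\pi}})\subset\mathbb{R}^n$ is a $k$-simplex; that is, the $k+1$ points $\boldsymbol{\pi},s(\boldsymbol{\pi}),\dots,s^k(\boldsymbol{\pi})=\mathbf{e}$ are affinely independent.
   Context: Permutations $\boldsymbol{\pi}=\pi_1\cdots\pi_n\in\mathfrak{S}_n$ are identified with points $(\pi_1,\dots,\pi_n)\in\mathbb{R}^n$; $\mathbf{e}=12\cdots n$. The stack-sorting map $s$: start with an empty stack and read $\pi_1,\dots,\pi_n$ from left to right; for each $\pi_k$, while the stack is nonempty and its top element $t$ satisfies $t<\pi_k$, pop $t$ and append it to the output; then push $\pi_k$. After reading all entries, pop the remaining stack elements one by one to the output. The output is $s(\boldsymbol{\pi})$; $s^j$ is the $j$-fold iterate. $\boldsymbol{\pi}$ is exactly $k$-stack-sortable if $s^k(\boldsymbol{\pi})=\mathbf{e}$ and $s^j(\boldsymbol{\pi})\ne\mathbf{e}$ for $j<k$. $\mathcal{S}^{\boldsymbol{\pi}}=\{\boldsymbol{\pi},s(\boldsymbol{\pi}),\dots,s^k(\boldsymbol{\pi})=\mathbf{e}\}$, and $\operatorname{conv}(\mathcal{S}^{\boldsymbol{\pi}})$ is the stack-sorting polytope of $\boldsymbol{\pi}$. *)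

(* Defs.v *)
From HB Require Import structures.
From mathcomp Require Import all_boot all_order all_algebra all_fingroup.
From mathcomp Require Import boolp classical_sets reals convex.

Set Implicit Arguments.
Unset Strict Implicit.
Unset Printing Implicit Defensive.

Import Order.TTheory GRing.Theory Num.Theory.

(** The stack is a list whose head is the top.  [pop_below x (out, st)] pops
    from [st] and appends to [out] as long as the top is smaller than [x]. *)
Section StackSortWords.
Variables (d : Order.disp_t) (T : orderType d).
Local Open Scope order_scope.

Fixpoint pop_below (x : T) (out st : seq T) : seq T * seq T :=
  if st is t :: st' then
    if t < x then pop_below x (rcons out t) st' else (out, st)
  else (out, st).

Definition read_entry (c : seq T * seq T) (x : T) : seq T * seq T :=
  let: (out, st) := pop_below x c.1 c.2 in (out, x :: st).

Definition stack_sort_word (w : seq T) : seq T :=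
  let: (out, st) := foldl read_entry ([::], [::]) w in out ++ st.

Lemma pop_below_cat x out st :
  (pop_below x out st).1 ++ (pop_below x out st).2 = out ++ st.
Proof.
elim: st out => [|t st IH] out //=; case: ifP => // _.
by rewrite IH cat_rcons.
Qed.

Lemma stack_sort_word_perm w : perm_eq (stack_sort_word w) w.
Proof.
suff H c : let: (out, st) := foldl read_entry c w in
    perm_eq (out ++ st) (c.1 ++ c.2 ++ w).
  by rewrite /stack_sort_word; case: foldl (H ([::], [::])).
elim: w c => [|x w IH] [out st] /=; first by rewrite cats0.
case: foldl (IH (read_entry (out, st) x)) => o s /permPl ->.
rewrite /read_entry /=; have := pop_below_cat x out st.
case: pop_below => o' s' /= E.
by rewrite [out ++ _]catA -E -catA perm_cat2l perm_sym -[x :: w]cat1s perm_catCA.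
Qed.

End StackSortWords.

(** Positions and entries are numbered from 0: the value [pi i : 'I_n] stands
    for the entry in position [i + 1], diminished by one.  Hence [1%g : 'S_n]
    is the permutation 12...n. *)
Definition one_line n (pi : 'S_n) : n.-tuple 'I_n := [tuple pi i | i < n].

Lemma stack_sort_size n (pi : 'S_n) : size (stack_sort_word (one_line pi)) == n.
Proof. by rewrite (perm_size (stack_sort_word_perm _)) size_tuple. Qed.

Definition stack_sort_fun n (pi : 'S_n) (i : 'I_n) : 'I_n :=
  tnth (Tuple (stack_sort_size pi)) i.

Lemma stack_sort_fun_inj n (pi : 'S_n) : injective (stack_sort_fun pi).
Proof.
apply/tuple_uniqP; rewrite /= (perm_uniq (stack_sort_word_perm _)) /=.
by rewrite map_inj_uniq ?enum_uniq //; exact: perm_inj.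
Qed.

Definition stack_sort n (pi : 'S_n) : 'S_n := perm (@stack_sort_fun_inj n pi).

Lemma one_line_stack_sort n (pi : 'S_n) :
  one_line (stack_sort pi) = stack_sort_word (one_line pi) :> seq 'I_n.
Proof.
have -> : one_line (stack_sort pi) = Tuple (stack_sort_size pi) by
  apply: eq_from_tnth => i; rewrite tnth_mktuple permE.
by [].
Qed.

Definition exactly_stack_sortable n (k : nat) (pi : 'S_n) : Prop :=
  iter k (@stack_sort n) pi = 1%g /\
  (forall j, (j < k)%N -> iter j (@stack_sort n) pi <> 1%g).

Local Open Scope classical_set_scope.
Local Open Scope ring_scope.

Definition perm_point (R : realType) n (pi : 'S_n) : 'rV[R]_n :=
  \row_(i < n) (pi i).+1%:R.

Definition stack_orbit (R : realType) n (k : nat) (pi : 'S_n) :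
    set 'rV[R]_n :=
  [set perm_point R (iter j (@stack_sort n) pi) | j in [set j | (j <= k)%N]].

Arguments stack_orbit R {n} k pi _.

Definition convex_hull (R : realType) n (A : set 'rV[R]_n) : set 'rV[R]_n :=
  smallest (@convex_set R 'rV[R]_n) A.

Definition affinely_independent (R : realType) n m (p : 'I_m -> 'rV[R]_n) :
    Prop :=
  forall c : 'I_m -> R,
    \sum_i c i = 0 -> \sum_i c i *: p i = 0 -> forall i, c i = 0.

Definition is_simplex (R : realType) n (k : nat) (D : set 'rV[R]_n) : Prop :=
  exists2 p : 'I_k.+1 -> 'rV[R]_n, affinely_independent p & D = convex_hull (range p).

(* Main.v *)
(** Once the entries in positions [>= a] are in place, one more application of
    the stack-sorting map also puts the entry in position [a - 1] in place,
    because the map moves the maximum of the remaining prefix to its end.  So the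
    last nonzero coordinates of the vectors [s^j(pi) - e], [j < k], are in
    strictly decreasing positions, and these vectors are linearly independent. *)
Require Import Defs.
From mathcomp Require Import all_boot all_order all_algebra all_fingroup.
From mathcomp Require Import boolp classical_sets reals convex.

Set Implicit Arguments.
Unset Strict Implicit.
Unset Printing Implicit Defensive.

Import Order.TTheory GRing.Theory Num.Theory.

Section Words.
Variables (d : Order.disp_t) (T : orderType d).
Implicit Types (x b : T) (u t out st : seq T).
Local Open Scope order_scope.

Lemma pop_below_all x out st :
  all (fun y => y < x) st -> pop_below x out st = (out ++ st, [::]).
Proof.
elim: st out => [|y st IH] out /=; first by rewrite cats0.
by case/andP=> -> /IH ->; rewrite cat_rcons.
Qed.

(** Reading an entry above all earlier ones empties the stack, so this entry alone remains on it and
    is output last. *)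
Lemma stack_sort_word_rcons u x :
  all (fun y => y < x) u ->
  stack_sort_word (rcons u x) = rcons (stack_sort_word u) x.
Proof.
move=> ux; have := perm_all (fun y => y < x) (stack_sort_word_perm u).
rewrite ux /stack_sort_word foldl_rcons.
case: foldl => out st; rewrite all_cat /read_entry => /andP[_ sx] /=.
by rewrite pop_below_all //= cats1.
Qed.

(** Each entry of [t] exceeds everything before it, so [t] can be peeled off from the right one
    entry at a time. *)
Lemma stack_sort_word_cat u t :
  allrel <%O u t -> sorted <%O t ->
  stack_sort_word (u ++ t) = stack_sort_word u ++ t.
Proof.
elim/last_ind: t => [|t x IH]; first by rewrite !cats0.
rewrite -cats1 allrel_catr (sorted_pairwise lt_trans) pairwise_cat.
case/andP=> ut ux /and3P[tx st _].
rewrite !catA cats1 stack_sort_word_rcons; last first.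
  rewrite all_cat; move: ux tx; rewrite !allrel1r => -> -> //.
by rewrite IH ?cats1 // (sorted_pairwise lt_trans).
Qed.

(** [last] reads the bottom of the stack, assumed to be its maximum. Either [x] exceeds it and
    everything is popped, leaving the default [x], or the bottom survives. *)
Lemma pop_below_last x out st :
  {in st, forall y, y <= last x st} ->
  last x (pop_below x out st).2 = Order.max x (last x st).
Proof.
elim: st out => [|y st IH] out /= le_last; first by rewrite maxxx.
case: ltP => [yx|xy] /=; last first.
  by rewrite (max_idPr _) // (le_trans xy) // le_last ?mem_head.
case: st IH le_last => [|z st] IH le_last /=.
  by rewrite (max_idPl _) // ltW.
by rewrite IH // => z' z'st; apply: le_last; rewrite inE z'st orbT.
Qed.

(** At every moment the bottom of the stack is the maximum of the entries read so far, and the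
    bottom is output last. *)
Lemma last_stack_sort_word x0 u :
  {in u, forall y, y <= last x0 (stack_sort_word u)}.
Proof.
(* Nonemptiness of the stack joins the invariant so that the default of [last] does not matter once
   something has been read. *)
suff : {in u, forall y, y <= last x0 (foldl (@read_entry _ T) ([::], [::]) u).2}
       /\ (u != [::] -> (foldl (@read_entry _ T) ([::], [::]) u).2 != [::]).
  case=> le_last st_neq0 y yu; move: (le_last y yu).
  have: u != [::] by case: (u) yu.
  move/st_neq0; rewrite /stack_sort_word; case: foldl => out [|z st] //= _.
  by rewrite last_cat.
elim/last_ind: u => [|u x [IH st_neq0]]; first by [].
have sub : {subset (foldl (@read_entry _ T) ([::], [::]) u).2 <= u}.
  move=> y yst; rewrite -(perm_mem (stack_sort_word_perm u)) /stack_sort_word.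
  by case: foldl yst => out st /= yst; rewrite mem_cat yst orbT.
rewrite foldl_rcons; case: foldl IH st_neq0 sub => out st /= IH st_neq0 sub.
rewrite /read_entry /=.
have last_x0 : u != [::] -> last x st = last x0 st.
  by move/st_neq0; case: (st).
have/(pop_below_last out) : {in st, forall y, y <= last x st}.
  move=> y yst; have yu := sub y yst.
  by rewrite last_x0; [exact: IH | case: (u) yu].
case: pop_below => out' st' /= ->; split=> // y; rewrite mem_rcons inE le_max.
case/predU1P=> [->|yu]; first by rewrite lexx.
by rewrite last_x0 ?IH ?orbT //; case: (u) yu.
Qed.

End Words.

Section Tails.
Variable n : nat.
Implicit Types (pi : 'S_n) (a : nat) (i : 'I_n).

Definition fixes_from a pi := forall i, a <= i -> pi i = i.

Lemma stack_sort_fixes_from a pi :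
  fixes_from a pi -> fixes_from a.-1 (stack_sort pi).
Proof.
(* If [n < a], no position [i < n] satisfies [a.-1 <= i]. *)
move=> fix_pi i ai; have [n0 | a_le_n] := ltnP n a.
  have: a.-1 < n := leq_ltn_trans ai (ltn_ord i).
  by rewrite -ltnS (ltn_predK n0) ltnNge n0.
set w := one_line pi.
have nthw (j : 'I_n) : nth i w j = pi j by rewrite -tnth_nth tnth_mktuple.
(* A value [pi j >= a] is itself a fixed position, so injectivity forces [pi j = j], against
   [j < a]. *)
have take_lt y : y \in take a w -> y < a.
  case/(nthP i) => j; rewrite size_take_min size_tuple (minn_idPl a_le_n) => ja <-.
  have jn := leq_trans ja a_le_n.
  rewrite nth_take // (nthw (Ordinal jn)) ltnNge; apply/negP => a_pij.
  have /perm_inj E := fix_pi _ a_pij.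
  by move: a_pij; rewrite E /= leqNgt ja.
have val_nth_drop (j : nat) : a + j < n -> nth i (drop a w) j = a + j :> nat.
  by move=> ajn; rewrite nth_drop (nthw (Ordinal ajn)) fix_pi //= leq_addr.
have size_dropw : size (drop a w) = n - a by rewrite size_drop size_tuple.
have drop_ge y : y \in drop a w -> a <= y.
  case/(nthP i) => j; rewrite size_dropw ltn_subRL => ja <-.
  by rewrite val_nth_drop ?leq_addr.
have sort_w : stack_sort_word w = stack_sort_word (take a w) ++ drop a w.
  rewrite -{1}(cat_take_drop a w) stack_sort_word_cat //.
    apply/allrelP => y z /take_lt ya /drop_ge az.
    by rewrite ltEord; exact: leq_trans ya az.
  apply/(sortedP i) => j; rewrite size_dropw ltn_subRL addnS => ja.
  by rewrite ltEord /= !val_nth_drop ?addnS // ltnW.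
have size_sort : size (stack_sort_word (take a w)) = a.
  by rewrite (perm_size (stack_sort_word_perm _)) size_takel ?size_tuple.
have -> : stack_sort pi i = nth i (stack_sort_word w) i.
  by rewrite permE /stack_sort_fun (tnth_nth i).
apply: ord_inj; rewrite sort_w nth_cat size_sort; case: ltnP => [ia|le_ai]; last first.
  by rewrite val_nth_drop subnKC.
have lt_sort y : y \in stack_sort_word (take a w) -> y < a.
  by rewrite (perm_mem (stack_sort_word_perm _)) => /take_lt.
(* Only position [a - 1] is left. The value [i] occurs in the prefix, whose entries are all at most
   [i], so it is the maximum that lands there. *)
have a_i : a = i.+1 by apply/eqP; rewrite eqn_leq ia andbT -ltnS; move: ai ia; case: (a).
set j := (pi^-1)%g i; have pij : pi j = i by rewrite permKV.
have ja : j < a.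
  by rewrite ltnNge; apply/negP => aj; move: (aj); rewrite -(fix_pi j aj) pij leqNgt ia.
have i_take : i \in take a w.
  by rewrite -pij -nthw -(nth_take i ja) mem_nth // size_takel ?size_tuple.
have := last_stack_sort_word i i_take.
rewrite (last_nth i) size_sort [X in nth _ _ X]a_i leEord => le_i.
apply/eqP; rewrite eqn_leq; apply/andP; split; last exact: le_i.
by rewrite -ltnS -a_i lt_sort // mem_nth // size_sort.
Qed.

Lemma iter_stack_sort_fixes_from a m pi :
  fixes_from a pi -> fixes_from a (iter m (@stack_sort n) pi).
Proof.
move=> fix_pi; elim: m => //= m IH i ai.
by apply: (stack_sort_fixes_from IH); exact: leq_trans (leq_pred a) ai.
Qed.

(** Locates the last nonzero coordinate of [pi - e]. *)
Lemma last_moved_entry pi :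
  pi <> 1%g -> exists2 i, pi i != i & fixes_from i.+1 pi.
Proof.
move=> pi_neq1; have [i0 pi_i0] : exists i, pi i != i.
  apply/existsP; rewrite -negb_forall; apply/negP => /forallP fix_pi.
  by apply: pi_neq1; apply/permP => i; rewrite perm1; exact/eqP.
case: (@arg_maxnP _ i0 (fun i => pi i != i) val pi_i0) => i pi_i max_i.
by exists i => // j; apply: contraTeq; rewrite -leqNgt; exact: max_i.
Qed.

End Tails.

Local Open Scope ring_scope.

Lemma perm_point_orbit_affinely_independent (R : realType) n k (pi : 'S_n) :
  exactly_stack_sortable k pi ->
  affinely_independent
    (fun j : 'I_k.+1 => perm_point R (iter j (@stack_sort n) pi)).
Proof.
case=> _ unsorted c sum_c sum_cp.
(* Since the coefficients sum to 0, [e] may be subtracted from every point. *)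
have sum_diff (i : 'I_n) :
    \sum_(j < k.+1) c j * ((iter j (@stack_sort n) pi i).+1%:R - i.+1%:R) = 0.
  under eq_bigr do rewrite mulrBr.
  rewrite sumrB -mulr_suml sum_c mul0r subr0.
  have /rowP/(_ i) := sum_cp; rewrite summxE [RHS]mxE.
  by under eq_bigr do rewrite !mxE.
(* Look at the last position moved by the [m]-th iterate: smaller indices vanish by induction, and
   all later iterates fix that position, so only the term of index [m] survives. *)
have c_lt_k m : (m < k)%N -> forall j : 'I_k.+1, j = m :> nat -> c j = 0.
  elim/ltn_ind: m => m IH mk j jm.
  have [i moved fixed] := last_moved_entry (unsorted m mk).
  have := sum_diff i; rewrite (bigD1 j) //= big1 => [|l l_neq_j].
    rewrite addr0 jm => /eqP; rewrite mulf_eq0 subr_eq0 eqr_nat eqSS.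
    by rewrite -[_ == _ :> nat]/(_ == _ :> 'I_n) (negPf moved) orbF => /eqP.
  have [lm|ml] := ltnP l m; first by rewrite (IH l) ?mul0r // (ltn_trans lm).
  have {}ml : (m < l)%N by rewrite ltn_neqAle ml andbT -jm eq_sym.
  rewrite -(subnK ml) addnS -addSn iterD (_ : _ - _ = 0) ?mulr0 //.
  have -> : iter (l - m.+1).+1 (@stack_sort n) (iter m (@stack_sort n) pi) i = i.
    rewrite iterSr; apply: iter_stack_sort_fixes_from (leqnn i).
    exact: stack_sort_fixes_from fixed.
  by rewrite subrr.
(* The last point is [e], whose difference is zero, so its coefficient must come from the vanishing
   sum of coefficients. *)
have c_k : c ord_max = 0.
  rewrite -sum_c big_ord_recr /= big1 ?add0r // => j _.
  exact: c_lt_k (ltn_ord j) _ _.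
move=> j; have [jk|kj] := ltnP j k; first exact: c_lt_k jk _ _.
rewrite -c_k; congr c; apply/val_inj/eqP.
by rewrite /= eqn_leq kj -ltnS ltn_ord.
Qed.

Theorem theorem3p3 (R : realType) (n k : nat) (pi : 'S_n)
    (hpi : exactly_stack_sortable k pi) :
  is_simplex k (convex_hull (stack_orbit R k pi)) /\
  affinely_independent
    (fun j : 'I_k.+1 => perm_point R (iter j (@stack_sort n) pi)).
Proof.
have indep := perm_point_orbit_affinely_independent (R := R) hpi.
split=> //; exists (fun j : 'I_k.+1 => perm_point R (iter j (@stack_sort n) pi)) => //.
congr convex_hull; apply/seteqP; split=> x /=.
  by case=> j /= jk <-; exists (Ordinal (jk : (j < k.+1)%N)).
by case=> j _ <-; exists (nat_of_ord j) => //=; rewrite -ltnS.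
Qed.
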